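(* For every integer $h\geq 0$, as formal power series, $$G_h(x)=F_h(1-e^{-x})=\frac{(1-e^{-x})^{h+1}}{p_{h+1}(1-e^{-x})\,p_h(1-e^{-x})}$$ and $$G_{\leq h}(x)=F_{\leq h}(1-e^{-x})=\frac{p_h(1-e^{-x})}{p_{h+1}(1-e^{-x})}.$$
   Context: All posets are finite. A semiorder is a poset with no induced subposet isomorphic to $\mathbf{2}+\mathbf{2}$ (disjoint union of two 2-element chains with no other comparabilities) or $\mathbf{3}+\mathbf{1}$ (disjoint union of a 3-element chain and a single incomparable element). Its length is the length of a longest chain (a chain with $\ell+1$ elements has length $\ell$). For $n\ge 0$, $f_h^n$ (resp. $f_{\leq h}^n$) is the number of nonisomorphic unlabeled semiorders with $n$ elements and length $h$ (resp. length at most $h$), and $g_h^n$ (resp. $g_{\leq h}^n$) is the number of labeled semiorders with $n$ elements, i.e. semiorder structures on the set $\{1,\dots,n\}$, of length $h$ (resp. length at most $h$). By convention $f_{\le h}^0=g_{\le h}^0=1$ and $f_h^0=g_h^0=0$ for all $h\ge 0$ (the empty poset has length $-1$). The generating functions are $F_h(x)=\sum_{n\ge0} f_h^n x^n$, $F_{\leq h}(x)=\sum_{n\ge0} f_{\leq h}^n x^n$, $G_h(x)=\sum_{n\ge0} g_h^n\frac{x^n}{n!}$, $G_{\leq h}(x)=\sum_{n\ge 0} g_{\leq h}^n\frac{x^n}{n!}$. The polynomials $p_h$ are defined by $p_0(x)=1$, $p_1(x)=1-x$, and $p_{h+1}(x)=p_h(x)-x\,p_{h-1}(x)$ for $h\ge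 1$. *)

(* Defs.v *)
From HB Require Import structures.
From mathcomp Require Import all_boot all_order all_algebra perm.

Set Implicit Arguments.
Unset Strict Implicit.
Unset Printing Implicit Defensive.

Import Order.TTheory GRing.Theory Num.Theory.
Local Open Scope ring_scope.

Section Posets.
Context {S T : finType}.
Implicit Types (q : rel S) (r : rel T).

Definition is_poset r : bool :=
  [&& [forall x, r x x],
      [forall x, forall y, r x y && r y x ==> (x == y)]
    & [forall x, forall y, forall z, r x y && r y z ==> r x z]].

Definition has_induced q r : bool :=
  [exists f : {ffun S -> T},
     injectiveb f && [forall x, forall y, r (f x) (f y) == q x y]].

Definition disjoint_union q r : rel (S + T) := fun a b =>
  match a, b with
  | inl x, inl y => q x y
  | inr x, inr y => r x y
  | _, _ => false
  end.

Definition is_chain r (A : {set T}) : bool :=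
  [forall x in A, forall y in A, r x y || r y x].

(* One less than the size of a largest chain; int-valued, so that the empty
   poset has length -1. *)
Definition poset_length r : int :=
  (\max_(A : {set T} | is_chain r A) #|A|)%:Z - 1.

End Posets.

Definition chain_rel (k : nat) : rel 'I_k := fun i j => (i <= j)%N.

Definition is_semiorder (T : finType) (r : rel T) : bool :=
  [&& is_poset r,
      ~~ has_induced (disjoint_union (@chain_rel 2) (@chain_rel 2)) r
    & ~~ has_induced (disjoint_union (@chain_rel 3) (@chain_rel 1)) r].

(* Binary relations on {0, ..., n-1} are represented by their graphs, so that
   they form a finite type. *)
Definition graph_rel (n : nat) (R : {set 'I_n * 'I_n}) : rel 'I_n :=
  fun x y => (x, y) \in R.

Definition isomorphic (n : nat) : rel {set 'I_n * 'I_n} := fun R R' =>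
  [exists s : 'S_n,
     [forall x, forall y, graph_rel R' (s x) (s y) == graph_rel R x y]].

Definition semiorders_eq (h n : nat) : {set {set 'I_n * 'I_n}} :=
  [set R | is_semiorder (graph_rel R) & poset_length (graph_rel R) == h%:Z].

Definition semiorders_le (h n : nat) : {set {set 'I_n * 'I_n}} :=
  [set R | is_semiorder (graph_rel R) & poset_length (graph_rel R) <= h%:Z].

Definition f_eq (h n : nat) : nat :=
  #|equivalence_partition (@isomorphic n) (semiorders_eq h n)|.
Definition f_le (h n : nat) : nat :=
  #|equivalence_partition (@isomorphic n) (semiorders_le h n)|.
Definition g_eq (h n : nat) : nat := #|semiorders_eq h n|.
Definition g_le (h n : nat) : nat := #|semiorders_le h n|.

(* A formal power series is its sequence of coefficients. *)
Definition fps (K : fieldType) := nat -> K.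

Section PowerSeries.
Variable K : fieldType.
Implicit Types a b u : fps K.

Definition fps_one : fps K := fun n => (n == 0%N)%:R.
Definition fps_sub a b : fps K := fun n => a n - b n.
Definition fps_mul a b : fps K := fun n => \sum_(i < n.+1) a i * b (n - i)%N.
Definition fps_pow a (k : nat) : fps K := iter k (fps_mul a) fps_one.
Definition fps_of_poly (p : {poly K}) : fps K := fun n => p`_n.

(* The substitution a(u), for u with zero constant term: u ^ k then has no
   terms of degree less than k, so the k > n do not contribute to degree n. *)
Definition fps_comp a u : fps K :=
  fun n => \sum_(k < n.+1) a k * fps_pow u k n.

(* The first n coefficients of the inverse of a. *)
Fixpoint fps_inv_seq a (n : nat) : seq K :=
  if n is m.+1 then
    let s := fps_inv_seq a m in
    rcons s ((a 0%N)^-1 *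
             ((m == 0%N)%:R - \sum_(i < m) s`_i * a (m - i)%N))
  else [::].

(* The multiplicative inverse, for a with nonzero constant term. *)
Definition fps_inv a : fps K := fun n => (fps_inv_seq a n.+1)`_n.
Definition fps_div a b : fps K := fps_mul a (fps_inv b).

Lemma size_fps_inv_seq a n : size (fps_inv_seq a n) = n.
Proof. by elim: n => //= n IHn; rewrite size_rcons IHn. Qed.

Lemma nth_fps_inv_seq a n i : (i < n)%N -> (fps_inv_seq a n)`_i = fps_inv a i.
Proof.
elim: n => // n IHn; rewrite ltnS leq_eqVlt => /orP[/eqP -> //|lt_in].
by rewrite /= nth_rcons size_fps_inv_seq lt_in IHn.
Qed.

Lemma fps_invE a n : fps_inv a n =
  (a 0%N)^-1 * (fps_one n - \sum_(i < n) fps_inv a i * a (n - i)%N).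
Proof.
rewrite {1}/fps_inv /= nth_rcons size_fps_inv_seq ltnn eqxx; congr (_ * (_ - _)).
by apply: eq_bigr => i _; rewrite nth_fps_inv_seq.
Qed.

Lemma fps_mulVf a : a 0%N != 0 -> fps_mul (fps_inv a) a =1 fps_one.
Proof.
move=> a0 n; rewrite /fps_mul big_ord_recr /= subnn (fps_invE a n).
by rewrite mulrAC mulVf // mul1r addrC subrK.
Qed.

End PowerSeries.

Definition F_eq (h : nat) : fps rat := fun n => (f_eq h n)%:R.
Definition F_le (h : nat) : fps rat := fun n => (f_le h n)%:R.
Definition G_eq (h : nat) : fps rat := fun n => (g_eq h n)%:R / n`!%:R.
Definition G_le (h : nat) : fps rat := fun n => (g_le h n)%:R / n`!%:R.

Fixpoint p_poly (h : nat) : {poly rat} :=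
  match h with
  | 0 => 1
  | 1 => 1 - 'X
  | (k.+1 as h').+1 => p_poly h' - 'X * p_poly k
  end.

(* The power series of exp(-x). *)
Definition exp_neg : fps rat := fun n => (-1) ^+ n / n`!%:R.

Definition one_sub_exp_neg : fps rat := fps_sub (@fps_one rat) exp_neg.

Definition p_fps (h : nat) : fps rat := fps_of_poly (p_poly h).

(* Main.v *)
(* A semiorder has nested down-sets and nested up-sets, so an automorphism, which
   preserves their sizes, moves every element to one with the same strict
   relations.  Hence the semiorders fixed by a permutation s are exactly the
   blow-ups of semiorders on the cycles of s, and Burnside's lemma gives
   n! f^n = sum over s in S_n of g^(number of cycles of s), that is
   F(x) = G(-log(1 - x)); the length is preserved by blow-ups.

   Sorting the elements by their traces identifies the unlabeled semiorders with
   the sequences d_0 <= ... <= d_(n-1), d_i <= i, where d_i is the number of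
   elements below the i-th one.  Scanning d level by level, by unit steps in the
   values and in the positions, shows that F_(<= h) = 1 / (1 - x F_(<= h-1)),
   which is the continued fraction with convergents p_h / p_(h+1).  The formula
   for F_h follows from p_h^2 - p_(h-1) p_(h+1) = x^(h+1). *)

Require Import Defs.
From HB Require Import structures.
From mathcomp Require Import all_boot all_order all_algebra.
From mathcomp Require Import fingroup perm action zify ring.
From mathcomp Require boolp.

Set Implicit Arguments.
Unset Strict Implicit.
Unset Printing Implicit Defensive.

Import Order.TTheory GRing.Theory Num.Theory.
Local Open Scope ring_scope.

(** * The ring of formal power series *)

Section FpsRing.
Variable K : fieldType.
Implicit Types a b c u : fps K.

HB.instance Definition _ := boolp.gen_eqMixin (fps K).
HB.instance Definition _ := boolp.gen_choiceMixin (fps K).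

Definition fps_zero : fps K := fun=> 0.
Definition fps_opp a : fps K := fun n => - a n.
Definition fps_add a b : fps K := fun n => a n + b n.

(** A coefficient of a product or of a substitution depends on finitely many coefficients, so the
    laws of power series are inherited from [{poly K}] through truncations; [fps_mul_coef] and
    [fps_comp_coef] make the transfer. *)
Definition truncp N a : {poly K} := \poly_(i < N) a i.

Lemma coef_truncp N a i : (i < N)%N -> (truncp N a)`_i = a i.
Proof. by move=> iN; rewrite coef_poly iN. Qed.

Lemma fps_mul_coef N a b (p q : {poly K}) n : (n < N)%N ->
  (forall i, (i < N)%N -> p`_i = a i) -> (forall i, (i < N)%N -> q`_i = b i) ->
  (p * q)`_n = fps_mul a b n.
Proof.
move=> nN pa qb; rewrite coefM; apply: eq_bigr => i _.
by rewrite pa ?qb //; [apply: leq_ltn_trans nN; rewrite leq_subr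
  | apply: leq_trans nN; rewrite ltn_ord].
Qed.

Lemma fps_mulE a b n : fps_mul a b n = (truncp n.+1 a * truncp n.+1 b)`_n.
Proof. by symmetry; apply: (@fps_mul_coef n.+1) => // i; apply: coef_truncp. Qed.

Fact fps_addA : associative fps_add.
Proof. by move=> a b c; apply/boolp.funext => n; apply: addrA. Qed.
Fact fps_addC : commutative fps_add.
Proof. by move=> a b; apply/boolp.funext => n; apply: addrC. Qed.
Fact fps_add0 : left_id fps_zero fps_add.
Proof. by move=> a; apply/boolp.funext => n; apply: add0r. Qed.
Fact fps_addN : left_inverse fps_zero fps_opp fps_add.
Proof. by move=> a; apply/boolp.funext => n; apply: addNr. Qed.

HB.instance Definition _ :=
  GRing.isZmodule.Build (fps K) fps_addA fps_addC fps_add0 fps_addN.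

Fact fps_mulA : associative (@fps_mul K).
Proof.
move=> a b c; apply/boolp.funext => n.
rewrite -(@fps_mul_coef n.+1 _ _ (truncp n.+1 a) (truncp n.+1 b * truncp n.+1 c)) //.
- rewrite mulrA; apply: (@fps_mul_coef n.+1) => // i iN; last exact: coef_truncp.
  by apply: (@fps_mul_coef n.+1) => // j; apply: coef_truncp.
- by move=> i; apply: coef_truncp.
- by move=> i iN; apply: (@fps_mul_coef n.+1) => // j; apply: coef_truncp.
Qed.

Fact fps_mulC : commutative (@fps_mul K).
Proof. by move=> a b; apply/boolp.funext => n; rewrite !fps_mulE mulrC. Qed.

Fact fps_mul1 : left_id (@fps_one K) (@fps_mul K).
Proof.
move=> a; apply/boolp.funext => n; rewrite -(@fps_mul_coef n.+1 _ _ 1 (truncp n.+1 a)) //.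
- by rewrite mul1r coef_truncp.
- by move=> i _; rewrite coef1.
- by move=> i; apply: coef_truncp.
Qed.

Fact fps_mulDl : left_distributive (@fps_mul K) fps_add.
Proof.
move=> a b c; apply/boolp.funext => n.
rewrite /fps_add /fps_mul -big_split; apply: eq_bigr => i _.
exact: mulrDl.
Qed.

Fact fps_oner_neq0 : (@fps_one K) != fps_zero.
Proof. by apply/eqP => /(congr1 (fun a => a 0%N))/eqP; rewrite oner_eq0. Qed.

HB.instance Definition _ := GRing.Zmodule_isComNzRing.Build (fps K)
  fps_mulA fps_mulC fps_mul1 fps_mulDl fps_oner_neq0.

Lemma coef_fpsD a b n : (a + b : fps K) n = a n + b n. Proof. by []. Qed.
Lemma coef_fpsB a b n : (a - b : fps K) n = a n - b n. Proof. by []. Qed.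
Lemma coef_fpsM a b n : (a * b : fps K) n = fps_mul a b n. Proof. by []. Qed.
Lemma coef_fps1 n : (1 : fps K) n = (n == 0%N)%:R. Proof. by []. Qed.
Lemma fps_subE a b : fps_sub a b = a - b. Proof. by []. Qed.

Lemma fps_powE a k : fps_pow a k = a ^+ k.
Proof. by elim: k => // k IHk; rewrite exprS -IHk. Qed.

Lemma fps_divP a b c : b 0%N != 0 -> c * b = a -> c = fps_div a b.
Proof.
move=> b0 <-; rewrite /fps_div -[fps_mul _ _]/(c * b * fps_inv b) -mulrA.
suff -> : b * fps_inv b = 1 by rewrite mulr1.
by rewrite mulrC; apply/boolp.funext => n; apply: fps_mulVf.
Qed.

Lemma coef_fps_powE N a (p : {poly K}) k n : (n < N)%N ->
  (forall i, (i < N)%N -> p`_i = a i) -> (p ^+ k)`_n = (a ^+ k) n.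
Proof.
move=> nN pa; elim: k n nN => [|k IHk] n nN; first by rewrite !expr0 coef1.
by rewrite !exprS coef_fpsM; apply: (fps_mul_coef nN).
Qed.

Lemma coef_pow_lt (p : {poly K}) k n : p`_0 = 0 -> (n < k)%N -> (p ^+ k)`_n = 0.
Proof.
move=> p0; elim: k n => // k IHk n; rewrite ltnS => nk.
rewrite exprS coefM big_ord_recl p0 mul0r add0r big1 // => i _.
rewrite IHk ?mulr0 //= /bump leq0n add1n; case: n nk i => [|n] nk i; first by case: i.
by rewrite subSS; apply: leq_ltn_trans (leq_subr _ _) nk.
Qed.

Lemma fps_pow_lt a k n : a 0%N = 0 -> (n < k)%N -> (a ^+ k) n = 0.
Proof.
move=> a0 nk; rewrite -(@coef_fps_powE n.+1 a (truncp n.+1 a)) //.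
  by rewrite coef_pow_lt // coef_truncp.
by move=> i; apply: coef_truncp.
Qed.

Lemma fps_comp_coef N a u (p q : {poly K}) n : u 0%N = 0 -> (n < N)%N ->
  (forall i, (i < N)%N -> p`_i = a i) -> (forall i, (i < N)%N -> q`_i = u i) ->
  (p \Po q)`_n = fps_comp a u n.
Proof.
move=> u0 nN pa qu; rewrite coef_comp_poly /fps_comp.
(* The polynomial composition sums up to the size of [p], [fps_comp] up to [n]. Over the common
   range [M] the surplus terms vanish: past its size [p] has zero coefficients, and past [n] the
   powers of [q] have no term of degree [n]. *)
pose M := maxn (size p) n.+1.
have q0 : q`_0 = 0 by rewrite qu ?u0 // (leq_trans _ nN).
rewrite (big_ord_widen M (fun k => p`_k * (q ^+ k)`_n)) ?leq_maxl // big_mkcond.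
rewrite (big_ord_widen M (fun k => a k * fps_pow u k n)) ?leq_maxr // [RHS]big_mkcond.
apply: eq_bigr => i _ /=; rewrite ltnS; case: (leqP i n) => [le_in | lt_ni].
  rewrite fps_powE (coef_fps_powE i nN qu) (pa _ (leq_ltn_trans le_in nN)).
  by case: ltnP => // sp; rewrite -(pa _ (leq_ltn_trans le_in nN)) nth_default ?mul0r.
by case: ifP => // _; rewrite coef_pow_lt // mulr0.
Qed.

Lemma fps_compM a b u : u 0%N = 0 ->
  fps_comp (a * b) u = fps_comp a u * fps_comp b u.
Proof.
move=> u0; apply/boolp.funext => n.
pose A := truncp n.+1 a; pose B := truncp n.+1 b; pose U := truncp n.+1 u.
have cU i : (i < n.+1)%N -> U`_i = u i by apply: coef_truncp.
have cA i : (i < n.+1)%N -> A`_i = a i by apply: coef_truncp.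
have cB i : (i < n.+1)%N -> B`_i = b i by apply: coef_truncp.
rewrite -(@fps_comp_coef n.+1 _ _ (A * B) U) //; last first.
  by move=> i iN; apply: (fps_mul_coef iN).
rewrite comp_polyM; apply: (@fps_mul_coef n.+1) => // i iN;
  exact: (fps_comp_coef u0 iN).
Qed.

Lemma fps_compB a b u : fps_comp (a - b) u = fps_comp a u - fps_comp b u.
Proof.
apply/boolp.funext => n; rewrite coef_fpsB /fps_comp -sumrB.
by apply: eq_bigr => i _; rewrite coef_fpsB mulrBl.
Qed.

Lemma fps_comp1 u : u 0%N = 0 -> fps_comp 1 u = 1.
Proof.
move=> u0; apply/boolp.funext => n.
rewrite /fps_comp big_ord_recl big1 ?addr0 => [|i _]; last by rewrite coef_fps1 mul0r.
by rewrite fps_powE expr0 coef_fps1 mul1r.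
Qed.

Definition fps_X : fps K := fun n => (n == 1%N)%:R.

Lemma fps_compX u : u 0%N = 0 -> fps_comp fps_X u = u.
Proof.
move=> u0; apply/boolp.funext => n; rewrite -(@fps_comp_coef n.+1 _ _ 'X (truncp n.+1 u)) //.
- by rewrite comp_polyX coef_truncp.
- by move=> i _; rewrite coefX.
- by move=> i; apply: coef_truncp.
Qed.

Lemma coef_fpsXM a n : (fps_X * a) n = if n is m.+1 then a m else 0.
Proof.
rewrite coef_fpsM -(@fps_mul_coef n.+1 _ _ 'X (truncp n.+1 a)) //; first last.
- by move=> i; apply: coef_truncp.
- by move=> i _; rewrite coefX.
rewrite mulrC coefMX; case: n => //= n; rewrite coef_truncp //.
Qed.

End FpsRing.


(** * The substitution x |-> 1 - exp(-x) *)

Section Derivation.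
Variable K : fieldType.
Implicit Types a b : fps K.

Lemma coef_fpsMn a k n : (a *+ k) n = a n *+ k :> K.
Proof. by elim: k => // k IHk; rewrite !mulrS coef_fpsD IHk. Qed.

Definition fps_deriv a : fps K := fun n => a n.+1 *+ n.+1.

Lemma fps_derivM a b :
  fps_deriv (a * b) = fps_deriv a * b + a * fps_deriv b.
Proof.
apply/boolp.funext => n; rewrite coef_fpsD.
(* Degree [n] of a derivative involves degree [n.+1], hence the truncation at [n.+2]. *)
pose A := truncp n.+2 a; pose B := truncp n.+2 b.
have cA i : (i < n.+2)%N -> A`_i = a i by apply: coef_truncp.
have cB i : (i < n.+2)%N -> B`_i = b i by apply: coef_truncp.
rewrite {1}/fps_deriv coef_fpsM -(@fps_mul_coef _ n.+2 _ _ A B) // -coef_deriv.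
rewrite derivM coefD; congr (_ + _); apply: (@fps_mul_coef _ n.+1) => // i iN;
  by rewrite ?coef_deriv ?cA ?cB // ltnW.
Qed.

Lemma fps_derivX a k : fps_deriv (a ^+ k.+1) = fps_deriv a * a ^+ k *+ k.+1.
Proof.
elim: k => [|k IHk]; first by rewrite expr0 mulr1 expr1 mulr1n.
by rewrite exprS fps_derivM IHk mulrnAr mulrCA -exprS -mulrS.
Qed.

End Derivation.

Local Notation uexp := one_sub_exp_neg.

Lemma one_sub_exp_neg0 : uexp 0%N = 0.
Proof. by rewrite /one_sub_exp_neg /fps_sub /exp_neg /fps_one expr0 fact0 divr1 subrr. Qed.

(** The differential equation u' = 1 - u is the source of the recurrence [exp_coefSS]. *)
Lemma deriv_one_sub_exp_neg : fps_deriv uexp = 1 - uexp.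
Proof.
have -> : 1 - uexp = exp_neg :> fps rat by rewrite /one_sub_exp_neg fps_subE subKr.
apply/boolp.funext => n; rewrite /fps_deriv /one_sub_exp_neg /fps_sub /exp_neg /fps_one.
have n0 : n.+1%:R != 0 :> rat by rewrite pnatr_eq0.
have f0 : n`!%:R != 0 :> rat by rewrite pnatr_eq0 -lt0n fact_gt0.
rewrite sub0r -[LHS]mulr_natl exprS factS natrM.
move: (n.+1%:R) (n`!%:R) ((-1) ^+ n) n0 f0 => a b c a0 b0.
by field; rewrite a0 b0.
Qed.

(** These are the signed Stirling numbers of the second kind, (-1)^(n-m) S(n,m). *)
Definition exp_coef n m : rat := n`!%:R / m`!%:R * (uexp ^+ m) n.

Lemma exp_coefS0 n : exp_coef n.+1 0 = 0.
Proof. by rewrite /exp_coef expr0 coef_fps1 mulr0. Qed.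

(** Coefficients are compared in (u^(m+1))' = (m+1) u^m (1 - u). *)
Lemma exp_coefSS n m :
  exp_coef n.+1 m.+1 = exp_coef n m - m.+1%:R * exp_coef n m.+1.
Proof.
have := congr1 (fun a : fps rat => a n) (fps_derivX uexp m).
rewrite deriv_one_sub_exp_neg mulrBl mul1r -exprS coef_fpsMn /fps_deriv.
rewrite coef_fpsB /exp_coef => E.
have m0 : m.+1%:R != 0 :> rat by rewrite pnatr_eq0.
have f0 : m`!%:R != 0 :> rat by rewrite pnatr_eq0 -lt0n fact_gt0.
transitivity (n`!%:R / m.+1`!%:R * ((uexp ^+ m.+1) n.+1 *+ n.+1)).
  by rewrite (factS n) natrM -mulr_natr; ring.
rewrite {}E (factS m) natrM -[(_ - _) *+ _]mulr_natr.
move: (m.+1%:R) (m`!%:R) m0 f0 => a b a0 b0.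
by field; rewrite a0 b0.
Qed.

Lemma exp_coef_lt n m : (n < m)%N -> exp_coef n m = 0.
Proof. by move=> nm; rewrite /exp_coef fps_pow_lt ?mulr0 // one_sub_exp_neg0. Qed.

(* Umbral evaluation of the rising factorial: t (t+1) ... (t+n-1) expanded in
   powers of t, with t^k replaced by g k. *)
Fixpoint rising (g : nat -> rat) n : rat :=
  if n is m.+1 then rising (g \o succn) m + m%:R * rising g m else g 0%N.

(** Stirling inversion: t^n expanded in rising factorials. The induction treats all [g] at once,
    because multiplication by t shifts [g]. *)
Lemma rising_inversion g n :
  \sum_(m < n.+1) exp_coef n m * rising g m = g n.
Proof.
elim: n g => [|n IHn] g.
  by rewrite big_ord1 /exp_coef expr0 /= fact0 coef_fps1 divr1 !mul1r.
rewrite big_ord_recl exp_coefS0 mul0r add0r.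
transitivity (\sum_(m < n.+1) exp_coef n m * rising (g \o succn) m); last exact: IHn.
under eq_bigr => i _ do rewrite lift0 exp_coefSS mulrBl.
rewrite sumrB; apply/eqP; rewrite subr_eq -subr_eq0 opprD addrA -sumrB; apply/eqP.
under eq_bigr => i _ do
  rewrite [rising g i.+1]/= mulrDr addrAC subrr add0r mulrCA mulrA.
(* Both remaining sums are the sum of [f] from 0 to [n.+1]: one lacks the top term, zero since
   [exp_coef n n.+1] is, the other lacks [f 0], zero by its factor m. *)
pose f m := m%:R * exp_coef n m * rising g m.
have -> : \sum_(i < n.+1) i%:R * exp_coef n i * rising g i = \sum_(i < n.+2) f i.
  by rewrite [RHS]big_ord_recr /= /f (exp_coef_lt (ltnSn n)) mulr0 mul0r addr0.
by rewrite big_ord_recl /= {1}/f !mul0r add0r subrr.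
Qed.

(** This is [rising_inversion] divided by n!; the hypothesis on [f] is what Burnside's lemma will
    supply. *)
Lemma comp_one_sub_exp_neg (f g : fps rat) (G : nat -> rat) :
    (forall n, f n = rising G n / n`!%:R) -> (forall n, g n = G n / n`!%:R) ->
  g = fps_comp f uexp.
Proof.
move=> fE gE; apply/boolp.funext => n; rewrite gE -(rising_inversion G) mulr_suml /fps_comp.
apply: eq_bigr => m _; rewrite fE fps_powE /exp_coef.
have n0 : n`!%:R != 0 :> rat by rewrite pnatr_eq0 -lt0n fact_gt0.
have m0 : m`!%:R != 0 :> rat by rewrite pnatr_eq0 -lt0n fact_gt0.
by field; rewrite n0 m0.
Qed.

(** * The polynomials p_h *)

Lemma p_fps0 : p_fps 0 = 1.
Proof. by apply/boolp.funext => n; apply: coef1. Qed.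

Lemma p_fps1 : p_fps 1 = 1 - fps_X rat.
Proof.
by apply/boolp.funext => n; rewrite coef_fpsB /p_fps /fps_of_poly coefB coef1 coefX.
Qed.

Lemma p_fpsS h : p_fps h.+2 = p_fps h.+1 - fps_X rat * p_fps h.
Proof.
apply/boolp.funext => n; rewrite coef_fpsB coef_fpsXM /p_fps /fps_of_poly.
by rewrite -[p_poly h.+2]/(p_poly h.+1 - 'X * p_poly h) coefB coefXM; case: n.
Qed.

(* p_{h-1}, with p_{-1} = 1 so that the recurrence extends to h = 0. *)
Definition p_pred h : fps rat := if h is k.+1 then p_fps k else 1.

Lemma p_predS h : p_fps h.+1 = p_fps h - fps_X rat * p_pred h.
Proof. by case: h => [|h]; rewrite /= ?p_fpsS // p_fps1 p_fps0 mulr1. Qed.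

(** A Cassini-type identity: by the recurrence, raising h by one multiplies the left-hand side by
    x. *)
Lemma p_fps_turan h :
  p_fps h ^+ 2 - p_pred h * p_fps h.+1 = fps_X rat ^+ h.+1.
Proof.
elim: h => [|h IHh]; first by rewrite p_fps1 p_fps0 /= expr1; ring.
rewrite [RHS]exprS -IHh (p_predS h.+1) [p_pred h.+1]/= (p_predS h).
by ring.
Qed.

Lemma coef0_comp (a : fps rat) : fps_comp a uexp 0%N = a 0%N.
Proof. by rewrite /fps_comp big_ord1 fps_powE expr0 coef_fps1 mulr1. Qed.

Lemma p_fps_coef0 h : p_fps h 0%N = 1.
Proof.
elim: h => [|h IHh]; first by rewrite p_fps0.
by rewrite p_predS coef_fpsB coef_fpsXM IHh subr0.
Qed.

Section ContinuedFraction.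
Variable F : nat -> fps rat.
Hypothesis F0 : F 0 = 1.
Hypothesis FS : forall k, F k.+1 = 1 + fps_X rat * F k * F k.+1.

(** By induction p_(h+1) = p_h - x p_(h-1) = p_h (1 - x F_h), and the last factor is inverse to
    F_(h+1). *)
Lemma F_mul_p h : F h * p_fps h = p_pred h.
Proof.
elim: h => [|h IHh]; first by rewrite F0 p_fps0 mulr1.
rewrite p_predS -IHh [p_pred h.+1]/=.
have F1 : F h.+1 - fps_X rat * F h * F h.+1 = 1 by rewrite {1}FS addrK.
by rewrite -[RHS]mulr1 -F1; ring.
Qed.

End ContinuedFraction.

Lemma fps_compXn k : fps_comp (fps_X rat ^+ k) uexp = uexp ^+ k.
Proof.
elim: k => [|k IHk]; first by rewrite !expr0 fps_comp1 // one_sub_exp_neg0.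
by rewrite !exprS fps_compM ?fps_compX ?IHk // one_sub_exp_neg0.
Qed.

(** * Semiorders as strict relations *)

Definition strict (T : eqType) (r : rel T) : rel T := fun x y => (x != y) && r x y.

Section SemiorderAxioms.
Variable T : finType.
Implicit Type r : rel T.

Lemma strictxx r x : strict r x x = false.
Proof. by rewrite /strict eqxx. Qed.

Lemma poset_strict r : is_poset r -> transitive (strict r).
Proof.
case/and3P=> _ /'forall_'forall_implyP anti /'forall_'forall_'forall_implyP trans y x z.
move=> /andP[xy rxy] /andP[yz ryz]; apply/andP; split; last by apply: (trans x y z); rewrite rxy.
apply: contraNneq xy => xz; rewrite -xz in ryz.
by apply: (anti x y); rewrite rxy.
Qed.

Lemma strictE r : reflexive r -> r =2 (fun x y => (x == y) || strict r x y).
Proof. by move=> rr x y; rewrite /strict; case: eqVneq => [->|_] /=; [apply: rr|]. Qed.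

(** The Scott-Suppes form of the axioms. The four elements may coincide, so the first condition
    contains transitivity ([b] equal to [c]) and antisymmetry. *)
Lemma semiorderP r : reflect
  [/\ reflexive r,
      forall a b c d, strict r a b -> strict r c d -> strict r a d || strict r c b
    & forall a b c d, strict r a b -> strict r b c -> strict r a d || strict r d c]
  (is_semiorder r).
Proof.
rewrite /is_semiorder; apply: (iffP and3P) => [[P /negP N22 /negP N31] | [rr A1 A2]].
- have st := poset_strict P.
  have rr : reflexive r by case/and3P: P => /forallP.
  have irr x := strictxx r x.
  (* Where a condition fails, the four elements are shown distinct and all their comparisons are
     determined; the table [E] then verifies the forbidden subposet pair by pair. In the first case
     [bc] denotes c < d. *)
  split=> // a b c d ab bc; apply/norP => -[nad ncb].
    have nN x y z : strict r x y -> strict r y z -> strict r x z by move=> xy; apply: st.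
    have asy x y : strict r x y -> strict r y x = false.
      by move=> xy; apply/negP => /(nN _ _ _ xy); rewrite irr.
    have Eab: a == b = false by apply/negP => /eqP E; move: ab; rewrite E irr.
    have Ecd: c == d = false by apply/negP => /eqP E; move: bc; rewrite E irr.
    have Eac: a == c = false by apply/negP => /eqP E; move: nad; rewrite E bc.
    have Ead: a == d = false by apply/negP => /eqP E; move: ncb; rewrite (nN _ _ _ bc) // -E.
    have Ebc: b == c = false by apply/negP => /eqP E; move: nad; rewrite (nN _ _ _ ab) // E.
    have Ebd: b == d = false by apply/negP => /eqP E; move: nad; rewrite -E ab.
    have Sac: strict r a c = false by apply/negP => E; move: nad; rewrite (nN _ _ _ E).
    have Sbc: strict r b c = false by apply/negP => E; move: Sac; rewrite (nN _ _ _ ab).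
    have Sbd: strict r b d = false by apply/negP => E; move: nad; rewrite (nN _ _ _ ab).
    have Sca: strict r c a = false by apply/negP => E; move: ncb; rewrite (nN _ _ _ E).
    have Sda: strict r d a = false by apply/negP => E; move: Sca; rewrite (nN _ _ _ bc).
    have Sdb: strict r d b = false by apply/negP => E; move: ncb; rewrite (nN _ _ _ bc).
    case: N22; apply/existsP; exists [ffun z : 'I_2 + 'I_2 => match z with
      | inl i => if i == ord0 then a else b | inr i => if i == ord0 then c else d end].
    have E := (Eab, Ecd, Eac, Ead, Ebc, Ebd, Sac, Sbc, Sbd, Sca, Sda, Sdb, ab, bc,
      (negbTE nad, negbTE ncb), asy _ _ ab, asy _ _ bc).
    apply/andP; split.
      apply/injectiveP => -[[[|[|i]] // ?]|[[|[|i]] // ?]] [[[|[|j]] // ?]|[[|[|j]] // ?]];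
        rewrite !ffunE /= => /eqP; rewrite ?(E, eq_sym _ a, eq_sym _ b, eq_sym d c) // => _;
        congr (_ _); exact: val_inj.
    apply/'forall_forallP => -[[[|[|i]] // ?]|[[|[|i]] // ?]] [[[|[|j]] // ?]|[[|[|j]] // ?]];
      by rewrite !ffunE /= strictE // ?(E, eqxx, eq_sym _ a, eq_sym _ b, eq_sym d c).
  have nN x y z : strict r x y -> strict r y z -> strict r x z by move=> xy; apply: st.
  have asy x y : strict r x y -> strict r y x = false.
    by move=> xy; apply/negP => /(nN _ _ _ xy); rewrite irr.
  have ac := nN _ _ _ ab bc.
  have Eab: a == b = false by apply/negP => /eqP E; move: ab; rewrite E irr.
  have Ebc: b == c = false by apply/negP => /eqP E; move: bc; rewrite E irr.
  have Eac: a == c = false by apply/negP => /eqP E; move: ac; rewrite E irr.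
  have Ead: a == d = false by apply/negP => /eqP E; move: ncb; rewrite -E ac.
  have Ebd: b == d = false by apply/negP => /eqP E; move: nad; rewrite -E ab.
  have Ecd: c == d = false by apply/negP => /eqP E; move: nad; rewrite -E ac.
  have Sda: strict r d a = false by apply/negP => E; move: ncb; rewrite (nN _ _ _ E).
  have Sdb: strict r d b = false by apply/negP => E; move: ncb; rewrite (nN _ _ _ E).
  have Sbd: strict r b d = false by apply/negP => E; move: nad; rewrite (nN _ _ _ ab).
  have Scd: strict r c d = false by apply/negP => E; move: nad; rewrite (nN _ _ _ ac).
  case: N31; apply/existsP; exists [ffun z : 'I_3 + 'I_1 => match z with
      | inl i => if val i == 0%N then a else if val i == 1%N then b else c | inr i => d end].
  have E := (Eab, Ebc, Eac, Ead, Ebd, Ecd, Sda, Sdb, Sbd, Scd, ab, bc, ac,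
      (negbTE nad, negbTE ncb), asy _ _ ab, asy _ _ bc, asy _ _ ac).
  apply/andP; split.
    apply/injectiveP => -[[[|[|[|i]]] // ?]|[[|i] // ?]] [[[|[|[|j]]] // ?]|[[|j] // ?]];
      rewrite !ffunE /= => /eqP; rewrite ?(E, eq_sym _ a, eq_sym _ b, eq_sym d c) // => _;
      congr (_ _); exact: val_inj.
  apply/'forall_forallP => -[[[|[|[|i]]] // ?]|[[|i] // ?]] [[[|[|[|j]]] // ?]|[[|j] // ?]];
    by rewrite !ffunE /= strictE // ?(E, eqxx, eq_sym _ a, eq_sym _ b, eq_sym d c).
split.
- apply/and3P; split; first by apply/forallP.
    apply/'forall_'forall_implyP => x y /andP[xy yx]; apply: contraT => nxy.
    have [] := orP (A1 x y y x _ _); rewrite /strict ?xy ?yx ?andbT // ?eqxx //.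
    by rewrite eq_sym.
  apply/'forall_'forall_'forall_implyP => x y z /andP[].
  rewrite strictE // => /orP[/eqP-> //|xy]; rewrite strictE // => /orP[/eqP<-|yz].
    by case/andP: xy.
  by have := A1 _ _ _ _ xy yz; rewrite strictxx orbF => /andP[].
- apply/existsP => -[f /andP[/injectiveP fI /'forall_forallP fE]].
  have S x y : strict r (f x) (f y) =
    strict (disjoint_union (@chain_rel 2) (@chain_rel 2)) x y.
    by rewrite /strict (inj_eq fI) (eqP (fE x y)).
  pose o0 : 'I_2 := ord0; pose o1 : 'I_2 := ord_max.
  by have := A1 (f (inl o0)) (f (inl o1)) (f (inr o0)) (f (inr o1));
    rewrite !S; move=> /(_ isT isT).
- apply/existsP => -[f /andP[/injectiveP fI /'forall_forallP fE]].
  have S x y : strict r (f x) (f y) =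
    strict (disjoint_union (@chain_rel 3) (@chain_rel 1)) x y.
    by rewrite /strict (inj_eq fI) (eqP (fE x y)).
  pose o1 : 'I_3 := Ordinal (isT : 1 < 3)%N.
  by have := A2 (f (inl ord0)) (f (inl o1)) (f (inl ord_max)) (f (inr ord0));
    rewrite !S; move=> /(_ isT isT).
Qed.

End SemiorderAxioms.

Lemma chain_card_le (T T' : finType) (r : rel T) (r' : rel T') (phi : T -> T') (A : {set T}) :
    reflexive r' -> (forall x y, strict r x y -> strict r' (phi x) (phi y)) ->
    is_chain r A -> is_chain r' (phi @: A) /\ #|phi @: A| = #|A|.
Proof.
move=> rr' hom /'forall_in_'forall_in_orP chA.
have neq x y : x \in A -> y \in A -> x != y ->
    (phi x != phi y) && (r' (phi x) (phi y) || r' (phi y) (phi x)).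
  move=> xA yA xy; case: (chA x xA y yA) => h.
    by have /hom/andP[-> ->] : strict r x y by rewrite /strict xy.
  have /hom/andP[nxy yx] : strict r y x by rewrite /strict eq_sym xy.
  by rewrite eq_sym nxy yx orbT.
split; last first.
  apply: card_in_imset => x y xA yA; apply: contra_eq => /(neq _ _ xA yA).
  by case/andP.
apply/'forall_in_'forall_in_orP => _ /imsetP[x xA ->] _ /imsetP[y yA ->].
have [->|xy] := eqVneq x y; first by left.
by apply/orP; case/andP: (neq _ _ xA yA xy).
Qed.

(** A strict homomorphism separates the elements of a chain. It may collapse incomparable elements,
    so it can be a rank function or the projection of a blow-up. *)
Lemma poset_length_le (T T' : finType) (r : rel T) (r' : rel T') (phi : T -> T') :
    reflexive r' -> (forall x y, strict r x y -> strict r' (phi x) (phi y)) ->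
  poset_length r <= poset_length r'.
Proof.
move=> rr' hom; rewrite /poset_length lerD2r lez_nat.
apply/bigmax_leqP => A /(chain_card_le rr' hom) [chA <-].
exact: leq_bigmax_cond.
Qed.

(** * Invariance of the axioms and the length under surjections reflecting the strict order *)

Section Transfer.
Variables (T T' : finType) (r : rel T) (r' : rel T') (phi : T -> T') (psi : T' -> T).
Hypothesis rr : reflexive r.
Hypothesis rr' : reflexive r'.
Hypothesis psiK : cancel psi phi.
Hypothesis phiE : forall x y, strict r x y = strict r' (phi x) (phi y).

Let psiE x y : strict r' x y = strict r (psi x) (psi y).
Proof. by rewrite phiE !psiK. Qed.

(** The conditions of [semiorderP] speak of the strict relation only and allow equal elements, so
    they pass through a non-injective [phi]. Relabellings and blow-ups are both covered. *)
Lemma transfer_semiorder : is_semiorder r = is_semiorder r'.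
Proof.
apply/semiorderP/semiorderP => -[_ A1 A2]; split=> // a b c d;
  by [rewrite !psiE; apply: A1 | rewrite !psiE; apply: A2
     |rewrite !phiE; apply: A1 | rewrite !phiE; apply: A2].
Qed.

Lemma transfer_length : poset_length r = poset_length r'.
Proof.
apply/le_anti/andP; split.
  by apply: (@poset_length_le _ _ _ _ phi) => // x y; rewrite phiE.
by apply: (@poset_length_le _ _ _ _ psi) => // x y; rewrite psiE.
Qed.

End Transfer.

(** * Counting isomorphism classes by Burnside's lemma *)

Section CycleCount.
Local Open Scope group_scope.

Lemma lift_perm_expg n (s : 'S_n) i (k : 'I_n) :
  (lift_perm ord0 ord0 s ^+ i) (lift ord0 k) = lift ord0 ((s ^+ i) k).
Proof.
elim: i k => [|i IHi] k; first by rewrite !expg0 !perm1.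
by rewrite !expgS !permM lift_perm_lift IHi.
Qed.

Lemma porbits_lift_perm n (s : 'S_n) :
  #|porbits (lift_perm ord0 ord0 s)| = #|porbits s|.+1.
Proof.
set L := lift_perm _ _ s.
have P0 : porbit L ord0 = [set ord0].
  apply/setP => x; rewrite !inE; apply/porbitP/eqP => [[i ->]|->]; last by exists 0%N; rewrite perm1.
  by elim: i => [|i IHi]; rewrite ?perm1 // expgS permM lift_perm_id.
have PL k : porbit L (lift ord0 k) = lift ord0 @: porbit s k.
  apply/setP => x; apply/porbitP/imsetP => [[i ->]|[y /porbitP[i ->] ->]].
    by exists ((s ^+ i) k); rewrite ?mem_porbit ?lift_perm_expg.
  by exists i; rewrite lift_perm_expg.
have lI : injective (fun A : {set 'I_n} => lift ord0 @: A).
  exact/imset_inj/lift_inj.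
have -> : porbits L = [set ord0] |: (fun A : {set 'I_n} => lift ord0 @: A) @: porbits s.
  apply/setP => A; rewrite !inE; apply/imsetP/orP => [[x _ ->]|[/eqP->|/imsetP[_ /imsetP[k _ ->] ->]]].
  - case: (unliftP ord0 x) => [k ->|->]; [right | by left; rewrite P0].
    by rewrite PL; apply: imset_f; apply: imset_f.
  - by exists ord0.
  - by exists (lift ord0 k).
rewrite cardsU1 card_imset // -[RHS]add1n; congr (_ + _)%N.
suff -> : ([set ord0] \notin (fun A : {set 'I_n} => lift ord0 @: A) @: porbits s) by [].
apply/imsetP => -[A _ /setP/(_ ord0)]; rewrite !inE eqxx => /esym/imsetP[k _ E].
by have := neq_lift ord0 k; rewrite -E eqxx.
Qed.

(** Every permutation of n+1 points is uniquely a transposition of [ord0] with some i times a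
    permutation fixing [ord0]. For i = [ord0] the fixed point adds a cycle; otherwise [ord0] joins
    an existing cycle. This is the recurrence of the unsigned Stirling numbers of the first kind. *)
Lemma sum_perm_recl (g : nat -> rat) n :
  \sum_(s : 'S_n.+1) g #|porbits s| =
    \sum_(s : 'S_n) g #|porbits s|.+1 + n%:R * \sum_(s : 'S_n) g #|porbits s|.
Proof.
pose f (p : 'I_n.+1 * 'S_n) := tperm ord0 p.1 * lift_perm ord0 ord0 p.2.
have fI : injective f.
  move=> [i s] [j t] E.
  (* The index [i] is recovered as the preimage of [ord0]. *)
  have ij : i = j.
    have := congr1 (fun u : 'S_n.+1 => u i) E.
    rewrite /f /= !permM tpermR lift_perm_id => /esym E0.
    have : tperm ord0 j i = ord0.
      by apply: (@perm_inj _ (lift_perm ord0 ord0 t)); rewrite E0 lift_perm_id.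
    by move=> /(congr1 (tperm ord0 j)); rewrite tpermK tpermL.
  rewrite -{j}ij in E *; congr (_, _); move/mulgI: E => E.
  apply/permP => k; apply: (@lift_inj _ ord0).
  by rewrite -!(lift_perm_lift ord0 ord0) E.
have fB : bijective f.
  apply: inj_card_bij fI _.
  by rewrite card_prod card_ord !card_Sn.
rewrite (reindex f) /=; last exact: onW_bij.
rewrite -(pair_bigA _ (fun i s => g #|porbits (f (i, s))|)) /= big_ord_recl.
congr (_ + _)%R.
  by apply: eq_bigr => s _; rewrite /f tperm1 mul1g porbits_lift_perm.
rewrite mulr_natl -[X in _ *+ X](card_ord n) -sumr_const.
apply: eq_bigr => i _; apply: eq_bigr => s _; congr g.
(* The transposition merges the singleton cycle of [ord0] with that of [lift ord0 i], which cancels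
   the extra cycle of the lift. *)
have := porbits_mul_tperm (lift_perm ord0 ord0 s) ord0 (lift ord0 i).
rewrite porbits_lift_perm neq_lift /=.
have -> : ord0 \notin porbit (lift_perm ord0 ord0 s) (lift ord0 i).
  apply/porbitP => -[k]; rewrite lift_perm_expg => /eqP; apply/negP; exact: neq_lift.
by rewrite addn2 addn1 => -[].
Qed.

End CycleCount.

Section Relabelling.
Variable n : nat.
Implicit Types (R : {set 'I_n * 'I_n}) (s : 'S_n).

Definition relabel R s : {set 'I_n * 'I_n} :=
  [set p | ((s^-1)%g p.1, (s^-1)%g p.2) \in R].

Lemma relabelE R s x y : graph_rel (relabel R s) (s x) (s y) = graph_rel R x y.
Proof. by rewrite /graph_rel inE /= !permK. Qed.

Fact relabel_is_action : is_action setT relabel.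
Proof.
apply: is_total_action => [R | R s t]; apply/setP => -[x y]; rewrite !inE /=.
  by rewrite invg1 !perm1.
by rewrite invMg !permM.
Qed.
Canonical relabel_action := Action relabel_is_action.

Lemma relabelK R s : relabel (relabel R s) s^-1%g = R.
Proof. exact: (actK relabel_action). Qed.

Lemma relabelM R s t : relabel R (s * t)%g = relabel (relabel R s) t.
Proof. exact: (actM relabel_action). Qed.

Lemma relabel_eq R R' s :
  (forall x y, graph_rel R' (s x) (s y) = graph_rel R x y) -> R' = relabel R s.
Proof.
move=> E; apply/setP => -[x y].
by have := E ((s^-1)%g x) ((s^-1)%g y); rewrite !permKV inE.
Qed.

Lemma isomorphicP R R' : reflect (exists s, R' = relabel R s) (isomorphic R R').
Proof.
apply: (iffP existsP) => -[s H]; exists s.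
  by apply: relabel_eq => x y; apply/eqP; move/'forall_forallP: H.
by apply/'forall_forallP => x y; rewrite H relabelE.
Qed.

Lemma relabel_refl R s : reflexive (graph_rel R) -> reflexive (graph_rel (relabel R s)).
Proof. by move=> rR x; rewrite -[x](permKV s) relabelE. Qed.

Lemma relabel_semiorder R s :
  is_semiorder (graph_rel (relabel R s)) = is_semiorder (graph_rel R).
Proof.
suff imp : forall R' t, is_semiorder (graph_rel R') -> is_semiorder (graph_rel (relabel R' t)).
  by apply/idP/idP => [/(imp _ (s^-1)%g)|]; [rewrite relabelK | apply: imp].
move=> R' t semiR; have [rR _ _] := semiorderP _ semiR.
rewrite (@transfer_semiorder _ _ _ (graph_rel R') (t^-1)%g t) //.
- exact: relabel_refl.
- exact: permK.
- by move=> x y; rewrite /strict (inj_eq perm_inj) /graph_rel inE.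
Qed.

Lemma relabel_length R s : reflexive (graph_rel R) ->
  poset_length (graph_rel (relabel R s)) = poset_length (graph_rel R).
Proof.
move=> rR; apply: (@transfer_length _ _ _ _ (s^-1)%g s) => //.
- exact: relabel_refl.
- exact: permK.
- by move=> x y; rewrite /strict (inj_eq perm_inj) /graph_rel inE.
Qed.

End Relabelling.

(** With [P] equal to [= h] or [<= h] this unfolds to [semiorders_eq] or [semiorders_le], so both
    counts are treated at once. *)
Definition semiorders (P : pred int) n : {set {set 'I_n * 'I_n}} :=
  [set R | is_semiorder (graph_rel R) & P (poset_length (graph_rel R))].

Section Burnside.
Variable P : pred int.

Lemma relabel_semiorders n (R : {set 'I_n * 'I_n}) s :
  (relabel R s \in semiorders P n) = (R \in semiorders P n).
Proof.
rewrite !inE relabel_semiorder; case: semiorderP => //= -[rR _ _].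
by rewrite relabel_length.
Qed.

(** Burnside's lemma: the isomorphism classes are the orbits of relabelling. *)
Lemma card_iso_classes n :
  (#|equivalence_partition (@isomorphic n) (semiorders P n)| * n`! =
    \sum_(s : 'S_n) #|[set R in semiorders P n | relabel R s == R]|)%N.
Proof.
have acts : [acts [set: 'S_n], on semiorders P n | relabel_action n].
  by apply/actsP => s _ R; apply: relabel_semiorders.
have := Frobenius_Cauchy acts; rewrite cardsT card_Sn => E.
transitivity (#|orbit (relabel_action n) [set: 'S_n] @: semiorders P n| * n`!)%N.
  congr (#|pred_of_set _| * _)%N; apply: eq_in_imset => R RS.
  apply/setP => R'; rewrite inE; apply/andP/imsetP => [[_ /isomorphicP[s ->]]|[s _ ->]].
    by exists s.
  by rewrite relabel_semiorders; split=> //; apply/isomorphicP; exists s.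
rewrite -E; apply: eq_big => [s | s _]; first by rewrite inE.
by apply: eq_card => R; rewrite !inE sub1set inE.
Qed.

End Burnside.

(** * Blow-ups of a relation along a map *)

Section Blowup.
Variables (n k : nat) (phi : 'I_n -> 'I_k).

(** Each point is replaced by its fibre under [phi], which becomes an antichain because [strict] is
    irreflexive. *)
Definition blowup (R : {set 'I_k * 'I_k}) : {set 'I_n * 'I_n} :=
  [set p | (p.1 == p.2) || strict (graph_rel R) (phi p.1) (phi p.2)].

Lemma blowup_refl R : reflexive (graph_rel (blowup R)).
Proof. by move=> x; rewrite /graph_rel inE eqxx. Qed.

Lemma strict_blowup R x y :
  strict (graph_rel (blowup R)) x y = strict (graph_rel R) (phi x) (phi y).
Proof.
rewrite {1}/strict /graph_rel inE /=.
by case: eqVneq => [->|//]; rewrite strictxx.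
Qed.

Lemma eq_graph (R R' : {set 'I_n * 'I_n}) :
    reflexive (graph_rel R) -> reflexive (graph_rel R') ->
  strict (graph_rel R) =2 strict (graph_rel R') -> R = R'.
Proof.
move=> rR rR' S; apply/setP => -[x y].
have := strictE rR x y; rewrite /graph_rel /= => ->.
have := strictE rR' x y; rewrite /graph_rel /= => ->.
by congr (_ || _); apply: S.
Qed.

End Blowup.

Section BlowupSection.
Variables (n k : nat) (phi : 'I_n -> 'I_k) (psi : 'I_k -> 'I_n).
Hypothesis psiK : cancel psi phi.

Lemma blowup_inj (R R' : {set 'I_k * 'I_k}) :
    reflexive (graph_rel R) -> reflexive (graph_rel R') ->
  blowup phi R = blowup phi R' -> R = R'.
Proof.
move=> rR rR' E; apply: eq_graph => // x y.
by have := strict_blowup phi R (psi x) (psi y); rewrite E strict_blowup !psiK.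
Qed.

Lemma blowup_semiorders P R : reflexive (graph_rel R) ->
  (blowup phi R \in semiorders P n) = (R \in semiorders P k).
Proof.
move=> rR; rewrite !inE.
rewrite (transfer_semiorder (blowup_refl phi R) rR psiK (strict_blowup phi R)).
by rewrite (transfer_length (blowup_refl phi R) rR psiK (strict_blowup phi R)).
Qed.

End BlowupSection.

(** * Nested traces and automorphisms *)

Section Traces.
Variables (T : finType) (r : rel T).
Hypothesis semir : is_semiorder r.

Definition down x : {set T} := [set y | strict r y x].
Definition up x : {set T} := [set y | strict r x y].

(** An element below [x] only and one below [y] only would violate the 2+2 axiom. *)
Lemma down_nested x y : (down x \subset down y) || (down y \subset down x).
Proof.
have [_ A1 _] := semiorderP _ semir.
have [//|/subsetPn[a]] := boolP (down x \subset down y).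
rewrite !inE => ax nay /=; apply/subsetP => c; rewrite !inE => cy.
by have := A1 _ _ _ _ ax cy; rewrite (negbTE nay).
Qed.

Lemma up_nested x y : (up x \subset up y) || (up y \subset up x).
Proof.
have [_ A1 _] := semiorderP _ semir.
have [//|/subsetPn[a]] := boolP (up x \subset up y).
rewrite !inE => xa nya /=; apply/subsetP => c; rewrite !inE => yc.
by have := A1 _ _ _ _ xa yc; rewrite (negbTE nya) orbF.
Qed.

Section Automorphism.
Variable s : {perm T}.
Hypothesis autos : forall x y, r (s x) (s y) = r x y.

Let strict_aut x y : strict r (s x) (s y) = strict r x y.
Proof. by rewrite /strict (inj_eq perm_inj) autos. Qed.

(* The down-sets of x and s x are nested and equipotent. *)
Lemma down_aut x : down (s x) = down x.
Proof.
have E : down (s x) = s @: down x.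
  apply/setP => y; rewrite inE -[y]((permKV s)) strict_aut.
  by rewrite mem_imset ?inE //; apply: perm_inj.
have C : #|down (s x)| = #|down x| by rewrite E card_imset //; apply: perm_inj.
by case/orP: (down_nested x (s x)) => ?; [apply/esym|]; apply/eqP; rewrite eqEcard C leqnn andbT.
Qed.

Lemma up_aut x : up (s x) = up x.
Proof.
have E : up (s x) = s @: up x.
  apply/setP => y; rewrite inE -[y]((permKV s)) strict_aut.
  by rewrite mem_imset ?inE //; apply: perm_inj.
have C : #|up (s x)| = #|up x| by rewrite E card_imset //; apply: perm_inj.
by case/orP: (up_nested x (s x)) => ?; [apply/esym|]; apply/eqP; rewrite eqEcard C leqnn andbT.
Qed.

(** Up-sets are constant along cycles, which moves the first argument; down-sets are too, which
    moves the second independently. Hence the relation descends to the cycles of [s]. *)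
Lemma strict_porbit x x' y y' : x' \in porbit s x -> y' \in porbit s y ->
  strict r x' y' = strict r x y.
Proof.
move=> /porbitP[i ->] /porbitP[j ->].
have Eu : up ((s ^+ i)%g x) = up x.
  by elim: i => [|i IHi]; rewrite ?perm1 // expgSr permM up_aut.
have Ed : down ((s ^+ j)%g y) = down y.
  by elim: j => [|j IHj]; rewrite ?perm1 // expgSr permM down_aut.
have /setP/(_ ((s ^+ j)%g y)) := Eu; rewrite !inE => ->.
by have /setP/(_ x) := Ed; rewrite !inE.
Qed.

End Automorphism.
End Traces.

Lemma porbit_quotient n (s : 'S_n) :
  exists phi : 'I_n -> 'I_#|porbits s|, exists2 psi : 'I_#|porbits s| -> 'I_n,
    cancel psi phi & forall x y, (phi x == phi y) = (x \in porbit s y).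
Proof.
have in_porbits x : porbit s x \in porbits s by apply: imset_f.
pose phi x := enum_rank_in (in_porbits x) (porbit s x).
have ex (i : 'I_#|porbits s|) : exists x, porbit s x == enum_val i.
  by have /imsetP[x _ ->] := enum_valP i; exists x.
have phiK x : enum_val (phi x) = porbit s x by rewrite /phi enum_rankK_in.
exists phi, (fun i => xchoose (ex i)) => [i | x y].
  by apply: enum_val_inj; rewrite phiK; apply/eqP/(xchooseP (ex i)).
by rewrite -(inj_eq enum_val_inj) !phiK eq_porbit_mem.
Qed.

(** Blowing up along the cycles is a bijection onto the semiorders fixed by [s]; its inverse
    restricts to one representative per cycle. *)
Lemma card_fixed P n (s : 'S_n) :
  #|[set R in semiorders P n | relabel R s == R]| = #|semiorders P #|porbits s| |.
Proof.
have [phi [psi psiK phiE]] := porbit_quotient s.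
have refl_semi m (R : {set 'I_m * 'I_m}) : R \in semiorders P m -> reflexive (graph_rel R).
  by rewrite inE => /andP[/semiorderP[]].
rewrite -(card_in_imset (f := blowup phi) (D := semiorders P _)); last first.
  by move=> R R' /refl_semi rR /refl_semi rR'; apply: blowup_inj psiK _ _ _ _.
congr #|pred_of_set _|; apply/setP => R; rewrite inE; apply/andP/imsetP.
  move=> [RS /eqP fixR]; have rR := refl_semi _ _ RS.
  have semiR : is_semiorder (graph_rel R) by move: RS; rewrite inE => /andP[].
  have autR x y : graph_rel R (s x) (s y) = graph_rel R x y by rewrite -{1}fixR relabelE.
  (* Since [psi] is injective, [blowup psi R] is the restriction of [R] to the representatives. *)
  have ER : R = blowup phi (blowup psi R).
    apply: eq_graph => //; first exact: blowup_refl.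
    move=> x y; rewrite !strict_blowup; apply/esym/(strict_porbit semiR autR);
      by rewrite -phiE psiK.
  exists (blowup psi R) => //.
  by rewrite -(blowup_semiorders psiK) -?ER //; apply: blowup_refl.
move=> [R' R'S ->]; have rR' := refl_semi _ _ R'S.
split; first by rewrite (blowup_semiorders psiK).
apply/eqP/esym/relabel_eq => x y.
rewrite /graph_rel !inE /= (inj_eq perm_inj).
have phis z : phi (s z) = phi z by apply/eqP; rewrite phiE (mem_porbit s 1).
by rewrite !phis.
Qed.

(** After Burnside, the sum of g(number of cycles) over all permutations obeys the recursion of
    [rising], by [sum_perm_recl]. *)
Lemma iso_classes_rising P n :
  #|equivalence_partition (@isomorphic n) (semiorders P n)|%:R =
    rising (fun k => #|semiorders P k|%:R) n / n`!%:R :> rat.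
Proof.
have n0 : n`!%:R != 0 :> rat by rewrite pnatr_eq0 -lt0n fact_gt0.
apply: (mulIf n0); rewrite divfK // -natrM card_iso_classes natr_sum.
under eq_bigr => s _ do rewrite card_fixed.
pose g k : rat := #|semiorders P k|%:R.
(* The recursion shifts [g], so the induction needs it arbitrary. *)
rewrite -[LHS]/(\sum_(s : 'S_n) g #|porbits s|) -[RHS]/(rising g n); move: g => g.
elim: n g {n0} => [|n IHn] g.
  rewrite (big_pred1 1%g) => [|s]; last by apply/esym/eqP/permP; case.
  congr g; apply/eqP; rewrite cards_eq0; apply/eqP/setP => A; rewrite inE.
  by apply/imsetP => -[[]].
by rewrite sum_perm_recl /= -!IHn.
Qed.

(** * Unlabeled semiorders as Dyck sequences *)

Section DyckSemiorders.
Local Open Scope nat_scope.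

Definition valid (d : seq nat) : bool :=
  sorted leq d && all (fun i => nth 0 d i <= i) (iota 0 (size d)).

(** The canonical form of a semiorder: the strict down-set of the i-th element is the initial
    segment of size d_i. *)
Definition dyck_rel n (d : seq nat) : {set 'I_n * 'I_n} :=
  [set p : 'I_n * 'I_n | (p.1 == p.2) || (p.1 < nth 0 d p.2)].

Lemma valid_nth d i : valid d -> nth 0 d i <= i.
Proof.
case/andP=> _ /allP H; case: (ltnP i (size d)) => [lt|ge]; last by rewrite nth_default.
by apply: H; rewrite mem_iota.
Qed.

Lemma valid_mono d i j : valid d -> i <= j -> j < size d -> nth 0 d i <= nth 0 d j.
Proof.
case/andP=> sd _ ij jd.
by apply: (sorted_leq_nth leq_trans leqnn) => //; rewrite inE (leq_ltn_trans ij).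
Qed.

Lemma dyck_refl n d : reflexive (graph_rel (dyck_rel n d)).
Proof. by move=> x; rewrite /graph_rel inE eqxx. Qed.

Lemma strict_dyck n d x y : valid d ->
  strict (graph_rel (dyck_rel n d)) x y = (x < nth 0 d y).
Proof.
move=> vd; rewrite /strict /graph_rel inE /=; case: eqVneq => //= <-.
by apply/esym/negbTE; rewrite -leqNgt valid_nth.
Qed.

(** The 2+2 axiom holds because initial segments are nested, the 3+1 axiom because [d] is
    nondecreasing. *)
Lemma dyck_semiorder n d : valid d -> size d = n -> is_semiorder (graph_rel (dyck_rel n d)).
Proof.
move=> vd sd; apply/semiorderP; split; first exact: dyck_refl.
  move=> a b c e; rewrite !strict_dyck // => ab ce.
  case: (leqP (nth 0 d b) (nth 0 d e)) => [le|lt]; first by rewrite (leq_trans ab le).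
  by rewrite (leq_trans ce (ltnW lt)) orbT.
move=> a b c e; rewrite !strict_dyck // => ab bc.
case: (ltnP a (nth 0 d e)) => //= ea; case: (ltnP e (nth 0 d c)) => // ce.
have be : b <= e by apply: leq_trans ce; apply: ltnW.
have := leq_trans ab (valid_mono vd be _); rewrite sd ltn_ord => /(_ isT).
by rewrite ltnNge ea.
Qed.

Lemma card_ord_lt n i : i <= n -> #|[set k : 'I_n | k < i]| = i.
Proof.
move=> le_in; rewrite -sum1_card (eq_bigl (fun k : 'I_n => k < i)) => [|k]; last by rewrite inE.
by rewrite (big_ord_narrow le_in) sum1_card card_ord.
Qed.

Lemma mem_initial_segment n (A : {set 'I_n}) (i : 'I_n) :
  (forall j k : 'I_n, j < k -> k \in A -> j \in A) -> (i \in A) = (i < #|A|).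
Proof.
move=> closedA; apply/idP/idP => [iA | ].
  rewrite -[i.+1](card_ord_lt (ltn_ord i)) subset_leq_card //.
  apply/subsetP => j; rewrite inE ltnS leq_eqVlt => /orP[/eqP/val_inj -> // | ji].
  exact: closedA ji iA.
apply: contraTT => niA; rewrite -leqNgt.
rewrite -[X in _ <= X](card_ord_lt (ltnW (ltn_ord i))) subset_leq_card //.
apply/subsetP => j jA; rewrite inE ltnNge leq_eqVlt.
apply: contra niA => /orP[/eqP/val_inj -> // | ij].
exact: closedA ij jA.
Qed.

(** A complete isomorphism invariant of semiorders, by [isomorphic_down_sizes]. *)
Definition down_sizes n (R : {set 'I_n * 'I_n}) : seq nat :=
  sort leq [seq #|down (graph_rel R) x| | x <- enum 'I_n].

Lemma nth_enum_map n (f : 'I_n -> nat) (i : 'I_n) : nth 0 [seq f x | x <- enum 'I_n] i = f i.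
Proof. by rewrite (nth_map i) ?nth_ord_enum // size_enum_ord. Qed.

Lemma down_sizes_dyck n d : valid d -> size d = n -> down_sizes (dyck_rel n d) = d.
Proof.
move=> vd sd; rewrite /down_sizes.
have -> : [seq #|down (graph_rel (dyck_rel n d)) x| | x <- enum 'I_n] = d.
  apply: (@eq_from_nth _ 0) => [|i]; rewrite size_map size_enum_ord ?sd // => lt_in.
  rewrite -[i]/(val (Ordinal lt_in)) nth_enum_map.
  rewrite -[RHS](@card_ord_lt n); last first.
    by apply: leq_trans (valid_nth _ vd) _; apply: ltnW.
  by apply: eq_card => y; rewrite !inE strict_dyck.
by apply: sorted_sort => //; [apply: leq_trans | case/andP: vd].
Qed.

Lemma card_down_relabel n (R : {set 'I_n * 'I_n}) s x :
  #|down (graph_rel (relabel R s)) (s x)| = #|down (graph_rel R) x|.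
Proof.
rewrite -[RHS](card_imset _ (@perm_inj _ s)); apply: eq_card => y.
rewrite -[y](permKV s) mem_imset; last exact: perm_inj.
by rewrite !inE /strict (inj_eq perm_inj) relabelE.
Qed.

Lemma card_up_relabel n (R : {set 'I_n * 'I_n}) s x :
  #|up (graph_rel (relabel R s)) (s x)| = #|up (graph_rel R) x|.
Proof.
rewrite -[RHS](card_imset _ (@perm_inj _ s)); apply: eq_card => y.
rewrite -[y](permKV s) mem_imset; last exact: perm_inj.
by rewrite !inE /strict (inj_eq perm_inj) relabelE.
Qed.

Lemma down_sizes_relabel n (R : {set 'I_n * 'I_n}) s :
  down_sizes (relabel R s) = down_sizes R.
Proof.
apply/perm_sortP; [exact: leq_total | exact: leq_trans | exact: anti_leq |].
have -> : [seq #|down (graph_rel R) x| | x <- enum 'I_n] =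
    [seq #|down (graph_rel (relabel R s)) x| | x <- [seq s x | x <- enum 'I_n]].
  by rewrite -[RHS]map_comp; apply/eq_in_map => x _; exact/esym/card_down_relabel.
apply: perm_map.
apply: uniq_perm; [exact: enum_uniq | by rewrite map_inj_uniq ?enum_uniq //; exact: perm_inj |].
move=> x; rewrite mem_enum inE; apply/esym/mapP; exists ((s^-1)%g x); rewrite ?permKV //.
by rewrite mem_enum.
Qed.

Section Key.
Variables (T : finType) (r : rel T).
Hypothesis semir : is_semiorder r.

(** One number per element, by which sorting makes the down-sets increase and the up-sets decrease
    simultaneously. *)
Definition trace_key x := #|down r x| + (#|T| - #|up r x|).

(* By the 3+1 axiom, down and up sets cannot both be strictly nested in the
   same direction. *)
Lemma trace_keyP x y : trace_key x <= trace_key y ->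
  (down r x \subset down r y) /\ (up r y \subset up r x).
Proof.
have [_ _ A2] := semiorderP _ semir.
rewrite leqNgt => key_le; split; apply: contraNT key_le => /[dup].
- move=> nsub /subsetPn[a]; rewrite !inE => ax nay.
  have sub_dn : down r y \proper down r x.
    by rewrite properE nsub andbT; case/orP: (down_nested semir x y) nsub => ->.
  have sub_up : up r x \subset up r y.
    by apply/subsetP => c; rewrite !inE => xc; have := A2 _ _ _ y ax xc; rewrite (negbTE nay).
  by rewrite -addSn leq_add ?proper_card // leq_sub2l ?subset_leq_card.
- move=> nsub /subsetPn[c]; rewrite !inE => yc nxc.
  have sub_up : up r x \proper up r y.
    by rewrite properE nsub andbT; case/orP: (up_nested semir x y) nsub => ->.
  have sub_dn : down r y \subset down r x.
    by apply/subsetP => a; rewrite !inE => ay; have := A2 _ _ _ x ay yc; rewrite (negbTE nxc) orbF.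
  have := proper_card sub_up; have := subset_leq_card sub_dn.
  (* This bound keeps the truncated subtraction in [trace_key] strictly monotone. *)
  have := subset_leq_card (subsetT (up r y)); rewrite cardsT /trace_key; lia.
Qed.

End Key.

Lemma trace_key_relabel n (R : {set 'I_n * 'I_n}) s x :
  trace_key (graph_rel (relabel R s)) (s x) = trace_key (graph_rel R) x.
Proof. by rewrite /trace_key card_down_relabel card_up_relabel. Qed.

Lemma sorted_semiorder n (R : {set 'I_n * 'I_n}) : is_semiorder (graph_rel R) ->
    (forall x y : 'I_n, x <= y ->
      trace_key (graph_rel R) x <= trace_key (graph_rel R) y) ->
  valid (down_sizes R) /\ R = dyck_rel n (down_sizes R).
Proof.
move=> semiR keyR; have [rR _ _] := semiorderP _ semiR.
have dnS (x y : 'I_n) : x <= y -> down (graph_rel R) x \subset down (graph_rel R) y.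
  by move=> /keyR /(trace_keyP semiR)[].
(* Up-sets shrink as the index grows, so every down-set is an initial segment, determined by its
   size. *)
have mem_dn x y : (x \in down (graph_rel R) y) = (x < #|down (graph_rel R) y|).
  apply: mem_initial_segment => j k jk; rewrite !inE => ky.
  have /(trace_keyP semiR)[_ /subsetP/(_ y)] := keyR _ _ (ltnW jk).
  by rewrite !inE; apply.
set d := [seq #|down (graph_rel R) x| | x <- enum 'I_n].
have sd : size d = n by rewrite size_map size_enum_ord.
have nthd (x : 'I_n) : nth 0 d x = #|down (graph_rel R) x| by apply: nth_enum_map.
have sortd : sorted leq d.
  apply/(sortedP 0) => i; rewrite sd => lt_in.
  have := nthd (Ordinal lt_in); have := nthd (Ordinal (ltnW lt_in)) => /= -> ->.
  by apply/subset_leq_card/dnS => /=.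
have -> : down_sizes R = d by apply: sorted_sort => //; apply: leq_trans.
split.
  rewrite /valid sortd; apply/allP => i; rewrite mem_iota sd /= => lt_in.
  rewrite -[i]/(val (Ordinal lt_in)) nthd leqNgt -mem_dn inE.
  by rewrite strictxx.
apply: eq_graph => //; first exact: dyck_refl.
move=> x y; rewrite [RHS]/strict /graph_rel inE /= nthd -mem_dn inE.
by rewrite /strict; case: eqVneq.
Qed.

(** Relabelling each element by its rank in the order of [trace_key] reduces to
    [sorted_semiorder]. *)
Lemma semiorder_canonical n (R : {set 'I_n * 'I_n}) : is_semiorder (graph_rel R) ->
  valid (down_sizes R) /\ exists s, relabel R s = dyck_rel n (down_sizes R).
Proof.
move=> semiR; set key := trace_key (graph_rel R).
pose e := sort (relpre key leq) (enum 'I_n).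
have se : size e == n by rewrite size_sort size_enum_ord.
have tI : injective (tnth (Tuple se)).
  by apply/tuple_uniqP; rewrite sort_uniq enum_uniq.
(* [tI] sends a rank to its element, whereas a relabelling must send the element to its rank. *)
pose s := (perm tI)^-1%g.
have keyE x : trace_key (graph_rel (relabel R s)) x = key (tnth (Tuple se) x).
  by rewrite -[x in LHS](permKV s) trace_key_relabel /s invgK permE.
have [] := @sorted_semiorder n (relabel R s).
- by rewrite relabel_semiorder.
- move=> x y xy; rewrite !keyE !(tnth_nth x) /=.
  have tr : transitive (relpre key leq) by move=> a b c; apply: leq_trans.
  have to : total (relpre key leq) by move=> a b; apply: leq_total.
  apply: (sorted_leq_nth tr _ x (sort_sorted to _)) => //; last 2 first.
  - by rewrite inE (eqP se).
  - by rewrite inE (eqP se).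
  by move=> a /=.
rewrite down_sizes_relabel => vd E; split=> //; by exists s.
Qed.

Lemma size_down_sizes n (R : {set 'I_n * 'I_n}) : size (down_sizes R) = n.
Proof. by rewrite size_sort size_map size_enum_ord. Qed.

Lemma isomorphic_down_sizes n (R R' : {set 'I_n * 'I_n}) :
    is_semiorder (graph_rel R) -> is_semiorder (graph_rel R') ->
  isomorphic R R' = (down_sizes R == down_sizes R').
Proof.
move=> /semiorder_canonical[_ [s Es]] /semiorder_canonical[_ [t Et]].
apply/isomorphicP/eqP => [[u ->]|E]; first by rewrite down_sizes_relabel.
by exists (s * t^-1)%g; rewrite relabelM Es E -Et relabelK.
Qed.

End DyckSemiorders.

(** * Counting Dyck sequences by levels *)

Section Levels.
Local Open Scope nat_scope.

(* s is the part of d from position t on, p the previous entry, st the position at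
   which the current level starts, and K the number of further levels allowed.  A
   position opens a new level iff st lies below it, i.e. iff its entry exceeds st. *)
Fixpoint levels_ok (K st t p : nat) (s : seq nat) : bool :=
  if s is d :: s' then
    [&& p <= d, d <= t &
      if d <= st then levels_ok K st t.+1 d s'
      else (0 < K) && levels_ok K.-1 t t.+1 d s']
  else true.

Lemma levels_ok_valid K st t p s : levels_ok K st t p s ->
  path leq p s && all (fun i => nth 0 s i <= t + i) (iota 0 (size s)).
Proof.
elim: s K st t p => //= d s IHs K st t p /and3P[pd dt H].
have /andP[-> all_s] : path leq d s && all (fun i => nth 0 s i <= t.+1 + i) (iota 0 (size s)).
  by case: ifP H => _ => [/IHs //|/andP[_ /IHs]].
rewrite pd addn0 dt /= -(addn0 1) iotaDl all_map.
by apply: sub_all all_s => i /=; rewrite addSnnS.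
Qed.

(* Invariant when position t is reached in level c: the levels found so far rank
   the positions below t strictly monotonically, and some chain with one element
   in each of the levels 0, ..., c ends at st. *)
Lemma levels_ok_rank_or_chain h D n K st t p c s :
    (forall j, nth 0 D j <= j) -> c + K = h -> size D = n -> drop t D = s ->
    path leq p s -> st <= t ->
    (exists l : nat -> nat, [/\ forall i j, j < t -> i < nth 0 D j -> l i < l j,
       forall i, i < t -> l i <= c & forall i, i < st -> l i < c]) ->
    (exists2 q, size q = c & sorted (fun i j => i < nth 0 D j) (rcons q st) && all (gtn st) q) ->
  if levels_ok K st t p s then
    exists l : nat -> nat, (forall i j, j < n -> i < nth 0 D j -> l i < l j) /\
      (forall i, i < n -> l i <= h)
  else exists2 q, size q = h.+2 & sorted (fun i j => i < nth 0 D j) q && all (gtn n) q.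
Proof.
move=> HD; elim: s K st t p c => [|d s IHs] K st t p c cK sD dropD.
  move=> _ _ [l [l1 l2 _]] _ /=; exists l.
  have le_nt : n <= t by have := size_drop t D; rewrite dropD sD /= => /esym/eqP.
  split=> [i j jn|i it]; first by apply: l1; apply: leq_trans le_nt.
  by apply: leq_trans (l2 i (leq_trans it le_nt)) _; rewrite -cK leq_addr.
have tn : t < n.
  by rewrite ltnNge -sD; apply/negP => /drop_oversize E; rewrite E in dropD.
move: dropD; rewrite (drop_nth 0) ?sD // => -[dE sE] /= /andP[pd ps] st_t [l [l1 l2 l3]] [q sq Hq].
have dt : d <= t by rewrite -dE.
rewrite pd dt /=; case: (leqP d st) => [d_st | st_d].
  (* Position [t] stays in the current level and gets rank [c]: what lies below it lies before [st],
     hence has smaller rank. *)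
  apply: (IHs K st t.+1 d c) => //; first exact: leqW.
  exists (fun i => if i == t then c else l i); split=> [i j|i|i ist].
  - rewrite ltnS leq_eqVlt => /orP[/eqP->|jt] iD.
      have ist : i < st by apply: leq_trans d_st; rewrite -dE.
      by rewrite eqxx (ltn_eqF (leq_trans ist st_t)) l3.
    by rewrite (ltn_eqF jt) (ltn_eqF (ltn_trans (leq_trans iD (HD j)) jt)) l1.
  - by rewrite ltnS leq_eqVlt; case: eqVneq => //= _ /l2.
  - by rewrite (ltn_eqF (leq_trans ist st_t)) l3.
  by exists q.
(* Here [st] is below [t], so [t] opens a new level and extends the chain. *)
have chain : sorted (fun i j => i < nth 0 D j) (rcons (rcons q st) t) && all (gtn t) (rcons q st).
  case/andP: Hq => sq' aq.
  have st_lt : st < t by apply: leq_trans dt.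
  apply/andP; split; last first.
    by rewrite all_rcons /= st_lt; apply: sub_all aq => i /= /ltn_trans; apply.
  case: q sq' {sq aq} => [_ | a q] /=; first by rewrite dE st_d.
  by rewrite !rcons_path last_rcons => ->; rewrite dE st_d.
case: K cK => [|K] cK /=.
  (* No level is left, so c = h, and the chain has c + 2 elements. *)
  exists (rcons (rcons q st) t); first by rewrite !size_rcons sq -cK addn0.
  case/andP: chain => -> aq /=; rewrite all_rcons /= tn.
  by apply: sub_all aq => i /= /ltn_trans; apply.
apply: (IHs K t t.+1 d c.+1) => //; first by rewrite addSnnS.
  exists (fun i => if i == t then c.+1 else l i); split=> [i j|i|i it].
  - rewrite ltnS leq_eqVlt => /orP[/eqP->|jt] iD.
      have it : i < t by apply: leq_trans (HD t).
      by rewrite eqxx (ltn_eqF it) ltnS l2.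
    by rewrite (ltn_eqF jt) (ltn_eqF (ltn_trans (leq_trans iD (HD j)) jt)) l1.
  - rewrite ltnS leq_eqVlt; case: eqVneq => //= _ /l2; exact: leqW.
  - by rewrite (ltn_eqF it) ltnS l2.
by exists (rcons q st); rewrite ?size_rcons ?sq.
Qed.

Lemma chain_rel_length k : poset_length (@chain_rel k) = (k%:Z - 1)%R.
Proof.
rewrite /poset_length; congr (Posz _ - _)%R; apply/eqP; rewrite eqn_leq; apply/andP; split.
  by apply/bigmax_leqP => A _; rewrite -[X in _ <= X](card_ord k) max_card.
apply: (@leq_trans #|[set: 'I_k]|); first by rewrite cardsT card_ord.
by apply: leq_bigmax_cond; apply/'forall_in_'forall_in_orP => i _ j _; apply/orP/leq_total.
Qed.

Lemma valid_path d : valid d -> path leq 0 d.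
Proof. by case: d => //= a s /andP[]. Qed.

(** A rank function with values 0, ..., h maps strictly into a chain of length h; in the other case
    a chain of h + 2 elements maps strictly into the poset. *)
Lemma levels_ok_length h n d : valid d -> size d = n ->
  levels_ok h 0 0 0 d = (poset_length (graph_rel (dyck_rel n d)) <= h%:Z)%R.
Proof.
move=> vd sd; have HD j := valid_nth j vd.
have := @levels_ok_rank_or_chain h d n h 0 0 0 0 d HD (add0n h) sd (drop0 d).
case: levels_ok => H.
  have [] // := H _ _ _ _; first exact: valid_path.
  - by exists (fun=> 0).
  - by exists [::].
  move=> l [l1 l2]; apply/esym.
  have -> : (h%:Z = poset_length (@chain_rel h.+1))%R by rewrite chain_rel_length; lia.
  apply: (@poset_length_le _ _ _ _ (fun x : 'I_n => inord (l x) : 'I_h.+1)).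
    by move=> i; apply: leqnn.
  move=> x y; rewrite strict_dyck // => xy.
  have lxy := l1 _ _ (ltn_ord y) xy.
  rewrite /strict /chain_rel -val_eqE /= !inordK ?ltnS ?l2 //.
  by rewrite (ltn_eqF lxy) ltnW.
have [] // := H _ _ _ _; first exact: valid_path.
- by exists (fun=> 0).
- by exists [::].
move=> q sq /andP[sortq allq]; apply/esym/negbTE; rewrite -ltNge.
have lt_q (i : 'I_h.+2) : nth 0 q i < n.
  by apply: (all_nthP 0 allq); rewrite sq.
apply: (@lt_le_trans _ _ (poset_length (@chain_rel h.+2))).
  by rewrite chain_rel_length; lia.
apply: (@poset_length_le _ _ _ _ (fun i => Ordinal (lt_q i))); first exact: dyck_refl.
move=> i j /andP[nij ij]; rewrite strict_dyck //=.
have tr : transitive (fun i j => i < nth 0 d j).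
  by move=> b a c ab bc; apply: (leq_trans ab); apply: leq_trans (HD b) (ltnW bc).
apply: (sorted_ltn_nth tr 0 sortq); rewrite ?inE ?sq ?ltn_ord //.
by rewrite ltn_neqAle nij.
Qed.

Fixpoint level_seqs (K st t p n : nat) : seq (seq nat) :=
  if n is m.+1 then
    [seq d :: s | d <- iota p (t.+1 - p),
       s <- if d <= st then level_seqs K st t.+1 d m
            else if K is K'.+1 then level_seqs K' t t.+1 d m else [::]]
  else [:: [::]].

Lemma mem_level_seqs K st t p n s :
  (s \in level_seqs K st t p n) = (size s == n) && levels_ok K st t p s.
Proof.
elim: n K st t p s => [|n IHn] K st t p [|d s] //=.
- by apply/negbTE/allpairsPdep => -[d [s []]].
rewrite eqSS; apply/allpairsPdep/idP => [[e [r [er rH [-> ->]]]] | /and4P[ss pd dt H]].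
  move: er; rewrite mem_iota => /andP[pe]; case: (leqP p t.+1) => [pt|/ltnW pt]; last first.
    by move: (pt); rewrite -subn_eq0 => /eqP ->; rewrite addn0 ltnNge pe.
  rewrite subnKC // ltnS => et; rewrite pe et /=.
  case: ifP rH => est; first by rewrite IHn.
  by case: K => [|K] //; rewrite IHn.
exists d, s; split=> //.
  by rewrite mem_iota pd /= subnKC ?ltnS // (leq_trans pd) // leqW.
case: ifP H => dst; first by rewrite IHn ss.
by case: K => [|K] //=; rewrite IHn ss.
Qed.

Lemma uniq_level_seqs K st t p n : uniq (level_seqs K st t p n).
Proof.
elim: n K st t p => //= n IHn K st t p.
apply: allpairs_uniq_dep; first exact: iota_uniq.
  by move=> d _; case: ifP => // _; case: K.
by move=> [a s] [b r] _ _ /= [-> ->].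
Qed.

(** The next entry either equals [p], which stays in the level and advances the position, or is
    larger, which raises the lower bound. *)
Lemma size_level_seqs_low K st t p n : p <= st -> st <= t ->
  size (level_seqs K st t p n.+1) =
    size (level_seqs K st t.+1 p n) + size (level_seqs K st t p.+1 n.+1).
Proof.
move=> p_st st_t; rewrite /= !size_allpairs_dep.
by rewrite subSn ?(leq_trans p_st) //= p_st subSS.
Qed.

(** With the lower bound past [st], the next entry must open a level at [t], so that level may be
    opened in advance at the cost of one unit of [K]. *)
Lemma size_level_seqs_next K st t n : st <= t ->
  size (level_seqs K.+1 st t st.+1 n) = size (level_seqs K t t st.+1 n).
Proof.
case: n => // n st_t; rewrite /= !size_allpairs_dep; congr sumn.
apply/eq_in_map => d; rewrite mem_iota subnKC // => /andP[st_d].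
by rewrite ltnS => d_t; rewrite d_t leqNgt st_d.
Qed.

Lemma size_level_seqs_last st t n : size (level_seqs 0 st t st.+1 n.+1) = 0.
Proof.
rewrite /= size_allpairs_dep sumnE big_map big_seq big1 // => d.
by rewrite mem_iota => /andP[st_d _]; rewrite leqNgt st_d.
Qed.

End Levels.

(** * Unlabeled counts and the continued fraction *)

Lemma card_equivalence_partition (T : finType) (U : eqType) (phi : T -> U)
    (e : rel T) (D : {set T}) (l : seq U) :
    uniq l -> (forall v, reflect (exists2 x, x \in D & phi x = v) (v \in l)) ->
    {in D &, forall x y, e x y = (phi x == phi y)} ->
  #|equivalence_partition e D| = size l.
Proof.
move=> ul lP eE; pose blk v := [set y in D | phi y == v].
rewrite -(size_map blk l) -(card_uniqP _).
  apply: eq_card => B; apply/imsetP/mapP => [[x xD ->] | [v /lP[x xD <-] ->]].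
    exists (phi x); first by apply/lP; exists x.
    by apply/setP => y; rewrite !inE; case: (boolP (y \in D)) => //= yD; rewrite eE // eq_sym.
  exists x => //.
  by apply/setP => y; rewrite !inE; case: (boolP (y \in D)) => //= yD; rewrite eE // eq_sym.
rewrite map_inj_in_uniq // => v w /lP[x xD <-] _ /setP/(_ x).
by rewrite !inE xD eqxx /= => /esym/eqP.
Qed.

Lemma f_leE h n : f_le h n = size (level_seqs h 0 0 0 n).
Proof.
apply: (card_equivalence_partition (phi := @down_sizes n)); first exact: uniq_level_seqs.
  move=> d; rewrite mem_level_seqs; apply: (iffP andP) => [[/eqP sd ok] | [R]].
    have vd : valid d.
      have /andP[sort_d all_d] := levels_ok_valid ok.
      by rewrite /valid all_d andbT; case: (d) sort_d => //= a s /andP[].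
    exists (dyck_rel n d); last exact: down_sizes_dyck.
    by rewrite inE dyck_semiorder // -levels_ok_length.
  rewrite inE => /andP[semiR lenR] <-; have [rR _ _] := semiorderP _ semiR.
  have [vd [s Es]] := semiorder_canonical semiR.
  rewrite size_down_sizes eqxx (@levels_ok_length h n) ?size_down_sizes //.
  by rewrite -Es relabel_length.
move=> R R'; rewrite !inE => /andP[semiR _] /andP[semiR' _].
exact: isomorphic_down_sizes.
Qed.

(** The continued fraction 1/(1 - x/(1 - x/...)) cut after k steps; [fracF k.+1] will be the series
    for length at most k. *)
Fixpoint fracF (k : nat) : fps rat :=
  if k is j.+1 then fps_inv (1 - fps_X rat * fracF j) else 1.

Lemma fracFS k : fracF k.+1 = 1 + fps_X rat * fracF k * fracF k.+1.
Proof.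
set b := 1 - fps_X rat * fracF k.
have E : fracF k.+1 * b = 1.
  apply/boolp.funext => n; apply: fps_mulVf.
  by rewrite coef_fpsB coef_fpsXM subr0 coef_fps1 oner_eq0.
by rewrite -{1}E /b; ring.
Qed.

Lemma fracF0 k : fracF k 0%N = 1.
Proof. by case: k => // k; rewrite fracFS coef_fpsD -mulrA coef_fpsXM addr0. Qed.

Lemma fps_pow0 (a : fps rat) k : a 0%N = 1 -> (a ^+ k) 0%N = 1.
Proof.
move=> a0; elim: k => // k IHk; rewrite exprS coef_fpsM /fps_mul big_ord1 subnn.
by rewrite a0 IHk mulr1.
Qed.

(** One factor F_(k+1) is replaced by 1 + x F_k F_(k+1). This mirrors the two choices of
    [size_level_seqs_low]. *)
Lemma fracF_step k m j n : (fracF k.+1 ^+ m.+1 * fracF k ^+ j) n.+1 =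
  (fracF k.+1 ^+ m.+1 * fracF k ^+ j.+1) n + (fracF k.+1 ^+ m * fracF k ^+ j) n.+1.
Proof.
have -> : fracF k.+1 ^+ m.+1 * fracF k ^+ j =
    fps_X rat * (fracF k.+1 ^+ m.+1 * fracF k ^+ j.+1) + fracF k.+1 ^+ m * fracF k ^+ j.
  move: (fracFS k); move: (fracF k.+1) (fracF k) => a b E.
  rewrite [in LHS]exprSr; transitivity (a ^+ m * (1 + fps_X rat * b * a) * b ^+ j).
    by rewrite -E.
  by rewrite !exprS; ring.
by rewrite coef_fpsD coef_fpsXM.
Qed.

(** Each value still available in the current level contributes a factor F_(K+1), and each position
    from [st] up to but excluding [t] a factor F_K. *)
Lemma size_level_seqs K st t p n : (st <= t)%N -> (p <= st.+1)%N ->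
  (size (level_seqs K st t p n))%:R =
    (fracF K.+1 ^+ (st.+1 - p) * fracF K ^+ (t - st)) n.
Proof.
(* Within a level, induction on [n] and then on [st.+1 - p] reduces to an exhausted level,
   [p = st.+1]. In degree 0 both sides are 1, so only positive degrees are assumed. *)
have inner k :
    (forall st t n, (st <= t)%N ->
       (size (level_seqs k st t st.+1 n.+1))%:R = (fracF k ^+ (t - st)) n.+1) ->
  forall st t p n, (st <= t)%N -> (p <= st.+1)%N ->
    (size (level_seqs k st t p n))%:R = (fracF k.+1 ^+ (st.+1 - p) * fracF k ^+ (t - st)) n.
  move=> H {K}st {}t {}p {}n; elim: n t p => [|n IHn] t p st_t p_st.
    by rewrite coef_fpsM /fps_mul big_ord1 !fps_pow0 ?mulr1 //; apply: fracF0.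
  move: {2}(st.+1 - p)%N (erefl (st.+1 - p)%N) => m; elim: m p p_st => [|m IHm] p p_st E.
    have -> : p = st.+1 by lia.
    by rewrite subnn expr0 mul1r H.
  rewrite size_level_seqs_low //; last by lia.
  rewrite natrD IHn ?IHm; try lia.
  have -> : (t.+1 - st = (t - st).+1)%N by lia.
  have -> : (st.+1 - p.+1 = m)%N by lia.
  by rewrite E fracF_step.
elim: K st t p n => [|K IHK]; apply: inner => st t n st_t.
  (* Without further levels no nonempty sequence remains, in agreement with [fracF 0 = 1]. *)
  by rewrite size_level_seqs_last /= expr1n coef_fps1.
rewrite size_level_seqs_next // IHK //.
by rewrite subnn expr0 mulr1 subSS.
Qed.

Lemma F_leE h : F_le h = fracF h.+1.
Proof.
apply/boolp.funext => n; rewrite /F_le f_leE size_level_seqs //.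
by rewrite !subnn expr0 mulr1 expr1.
Qed.

(** * Labeled counts and the closed formulas *)

Lemma G_leE h : G_le h = fps_comp (F_le h) one_sub_exp_neg.
Proof.
apply: (comp_one_sub_exp_neg (G := fun k => (g_le h k)%:R)) => // n.
exact: (iso_classes_rising (fun l => l <= h%:Z)).
Qed.

Lemma G_eqE h : G_eq h = fps_comp (F_eq h) one_sub_exp_neg.
Proof.
apply: (comp_one_sub_exp_neg (G := fun k => (g_eq h k)%:R)) => // n.
exact: (iso_classes_rising (fun l => l == h%:Z)).
Qed.

Lemma poset_length_lt0 (T : finType) (r : rel T) : reflexive r ->
  (poset_length r < 0) = (#|T| == 0%N).
Proof.
move=> rr; rewrite /poset_length; have [x _|T0] := pickP T; last first.
  rewrite (eq_card0 T0) eqxx; rewrite big1 // => A _.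
  by apply/eqP; rewrite cards_eq0; apply/eqP/setP => y; have := T0 y.
have -> : (#|T| == 0%N) = false by apply/negbTE; rewrite -lt0n; apply/card_gt0P; exists x.
apply/negbTE; rewrite -leNgt subr_ge0 lez_nat -(cards1 x).
apply: leq_bigmax_cond; apply/'forall_in_'forall_in_orP => y /set1P-> z /set1P->.
by left.
Qed.

Lemma g_leS h n : g_le h.+1 n = (g_le h n + g_eq h.+1 n)%N.
Proof.
rewrite /g_le /g_eq -cardsUI [X in (_ + X)%N](_ : _ = 0%N) ?addn0.
  congr #|pred_of_set _|; apply/setP => R; rewrite !inE -andb_orr; congr (_ && _); lia.
apply/eqP; rewrite cards_eq0 -subset0; apply/subsetP => R; rewrite !inE.
by move=> /andP[/andP[_ le] /andP[_ /eqP E]]; move: le; rewrite E; lia.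
Qed.

(** The empty poset has length -1, so it is counted by [g_le 0] but not by [g_eq 0]. *)
Lemma g_le0 n : g_le 0 n = ((n == 0)%N + g_eq 0 n)%N.
Proof.
have rS P (R : {set 'I_n * 'I_n}) : R \in semiorders P n -> reflexive (graph_rel R).
  by rewrite inE => /andP[/semiorderP[]].
have [n0 | npos] := posnP n.
  have len (R : {set 'I_n * 'I_n}) : reflexive (graph_rel R) -> poset_length (graph_rel R) < 0.
    by move=> rR; rewrite poset_length_lt0 // card_ord n0.
  have -> : g_eq 0 n = 0%N.
    apply/eqP; rewrite cards_eq0 -subset0; apply/subsetP => R RS.
    have := len _ (rS (fun l => l == 0) _ RS); move: RS; rewrite inE => /andP[_ /eqP ->].
    by rewrite ltxx.
  have no (x : 'I_n) : False by have := ltn_ord x; rewrite [X in (_ < X)%N]n0.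
  rewrite addn0; apply/eqP/cards1P; exists set0.
  apply/setP => R; rewrite in_set1 inE.
  have -> : R = set0 by apply/setP => -[x]; case: (no x).
  rewrite eqxx; apply/andP; split; last by apply/ltW/len => x; case: (no x).
  by apply/semiorderP; split=> x; case: (no x).
rewrite add0n; congr #|pred_of_set _|; apply/setP => R; rewrite !inE.
case: semiorderP => //= -[rR _ _]; rewrite eq_le andb_idr // => _.
by rewrite leNgt poset_length_lt0 // card_ord (gtn_eqF npos).
Qed.

Lemma G_leS h : G_le h.+1 = G_le h + G_eq h.+1.
Proof.
by apply/boolp.funext => n; rewrite coef_fpsD /G_le /G_eq g_leS natrD mulrDl.
Qed.

Lemma G_le0 : G_le 0 = 1 + G_eq 0.
Proof.
apply/boolp.funext => n; rewrite coef_fpsD /G_le /G_eq g_le0 natrD mulrDl coef_fps1.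
by case: n => // n; rewrite mul0r.
Qed.

Theorem corollary3p5 (h : nat) :
  let u := one_sub_exp_neg in
  (G_eq h =1 fps_comp (F_eq h) u /\
   fps_comp (F_eq h) u =1
     fps_div (fps_pow u h.+1)
             (fps_mul (fps_comp (p_fps h.+1) u) (fps_comp (p_fps h) u))) /\
  (G_le h =1 fps_comp (F_le h) u /\
   fps_comp (F_le h) u =1
     fps_div (fps_comp (p_fps h) u) (fps_comp (p_fps h.+1) u)).
Proof.
move=> u.
have u0 : u 0%N = 0 by apply: one_sub_exp_neg0.
pose c a := fps_comp a u.
have cM a b : c (a * b) = c a * c b by apply: fps_compM.
have c_p0 k : c (p_fps k) 0%N = 1 by rewrite /c coef0_comp p_fps_coef0.
have le_p k : c (F_le k) * c (p_fps k.+1) = c (p_fps k).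
  by rewrite -cM F_leE (F_mul_p (erefl _) fracFS).
(* The difference p_h/p_(h+1) - p_(h-1)/p_h has numerator p_h^2 - p_(h-1) p_(h+1), which
   [p_fps_turan] evaluates. *)
have eq_p : c (F_eq h) * (c (p_fps h.+1) * c (p_fps h)) = u ^+ h.+1.
  have <- : c (p_fps h) * c (p_fps h) - c (p_pred h) * c (p_fps h.+1) = u ^+ h.+1.
    by rewrite -!cM -[LHS]fps_compB -expr2 p_fps_turan fps_compXn.
  (* The splitting by length is made on labeled counts, which are cardinalities of disjoint sets,
     and reaches [F_eq] through the substitution identity. *)
  have -> : c (F_eq h) = G_eq h by rewrite G_eqE.
  have leE k : G_le k = c (F_le k) by rewrite G_leE.
  case: h => [|k].
    (* For h = 0 the empty poset's series 1 takes the place of length at most h - 1, matching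
       [p_pred 0 = 1]. *)
    have -> : G_eq 0 = c (F_le 0) - 1 by rewrite -leE G_le0 addrC addKr.
    have c1 : c 1 = 1 by apply: fps_comp1.
    have := le_p 0%N; rewrite p_fps0 /p_pred c1 => E.
    by rewrite mulr1 mulrBl E !mul1r.
  have -> : G_eq k.+1 = c (F_le k.+1) - c (F_le k) by rewrite -!leE G_leS addrC addKr.
  by rewrite [p_pred _]/= -(le_p k) -(le_p k.+1); ring.
split; split=> n; rewrite ?G_leE ?G_eqE //.
- rewrite fps_powE; congr (_ n); apply: fps_divP eq_p.
  by rewrite coef_fpsM /fps_mul big_ord1 !c_p0 mulr1 oner_eq0.
- by congr (_ n); apply: fps_divP (le_p h); rewrite c_p0 oner_eq0.
Qed.
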